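(* Let $N_1,N_2\in\mathbb N$, $(\mathfrak L,\Lambda)\in\mathbf{StIP}_{N_1}\times\mathbf S_{N_1}$ and $(\mathfrak M,M)\in\mathbf{StIP}_{N_2}\times\mathbf S_{N_2}$. Then for all $(\mathfrak s,\sigma)\in\bigcup_{n\in\mathbb N}\mathbf{StIP}_n\times\mathbf S_n$, $$\big\langle\mathsf{GPC}\big((\mathfrak L,\Lambda)\blacksquare(\mathfrak M,M)\big),(\mathfrak s,\sigma)\big\rangle=\big\langle\mathsf{GPC}\big((\mathfrak L,\Lambda)\big)\otimes\mathsf{GPC}\big((\mathfrak M,M)\big),\,\Delta_\blacksquare((\mathfrak s,\sigma))\big\rangle .$$
   Context: $\mathbb N=\{0,1,2,\dots\}$, $\mathbb N_{\ge1}=\{1,2,\dots\}$, $[n]=\{1,\dots,n\}$, $[0]=\emptyset$. For a finite set $A\subset\mathbb N_{\ge1}$, an interval partition of $A$ is a finite set $\mathcal I$ of non-empty pairwise disjoint sets (blocks) with union $A$, each block being an interval of $\mathbb N_{\ge1}$ (a set of consecutive integers $\{a,a+1,\dots,b\}$). $\mathbf{IP}(A)$ is the set of these ($\mathbf{IP}(\emptyset)=\{\emptyset\}$), $\mathbf{IP}=\bigcup_A\mathbf{IP}(A)$, and $\bigcup\mathcal I$ denotes the ground set of $\mathcal I$. $\mathbf{StIP}_n:=\mathbf{IP}([n])$. $\mathbf S_n$ is the symmetric group on $[n]$ ($\mathbf S_0$ contains only the empty permutation), permutations being written in one-line notation $\sigma=\sigma_1\cdots\sigma_n$. Order: for $\mathcal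 I,\mathcal J\in\mathbf{IP}$, $\mathcal I\le\mathcal J$ means $\bigcup\mathcal I=\bigcup\mathcal J$ and every block of $\mathcal I$ is contained in a block of $\mathcal J$. Standardization of partitions: for $\mathcal I\in\mathbf{IP}$ with $|\bigcup\mathcal I|=n$, $\mathbf{std}(\mathcal I)\in\mathbf{StIP}_n$ is the image of $\mathcal I$, block by block, under the unique order-preserving bijection $\bigcup\mathcal I\to[n]$. Standardization of permutations: for $\sigma\in\mathbf S_n$ and $A=\{a_1<\dots<a_k\}\subset[n]$ (positions), $\mathbf{st}(\sigma|_A)\in\mathbf S_k$ is the permutation with the same relative order as $\sigma_{a_1}\cdots\sigma_{a_k}$. Cliques: for finite $A\subset\mathbb N_{\ge1}$, $\mathbf{cliques}(A)$ is the set of maximal runs of consecutive integers in $A$. For $\mathcal I\in\mathbf{IP}$, $\mathcal I(A):=\{E\cap c\mid E\in\mathcal I,\ c\in\mathbf{cliques}(A)\}\setminus\{\emptyset\}$, an interval partition of $A\cap\bigcup\mathcal I$. $\mathcal H_{\mathrm{vinc}}$ is the free $\mathbb Q$-vector space on $\bigcup_n\mathbf{StIP}_n\times\mathbf S_n$. On basis elements, $(\mathfrak s,\sigma)\blacksquare(\mathfrak t,\tau):=(\mathfrak s\bullet\mathfrak t,\sigma\,\square\,\tau)$, where $\mathfrak s\bullet\mathfrak t$ consists of the blocks of $\mathfrak s$ together with the blocks of $\mathfrak t$ translated by $|\bigcup\mathfrak s|$, and $\sigma\,\square\,\tau:=\sigma_1\cdots\sigma_m(\tau_1+m)\cdots(\tau_n+m)$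 for $\sigma\in\mathbf S_m,\tau\in\mathbf S_n$. The dual coproduct is $\Delta_\blacksquare((\mathfrak s,\sigma)):=\sum(\mathfrak a,\alpha)\otimes(\mathfrak b,\beta)$, the sum over all basis elements $(\mathfrak a,\alpha),(\mathfrak b,\beta)$ with $\mathfrak a\bullet\mathfrak b=\mathfrak s$ and $\alpha\,\square\,\beta=\sigma$. Signature: for $(\mathfrak L,\Lambda)\in\mathbf{StIP}_N\times\mathbf S_N$, $\mathsf{GPC}((\mathfrak L,\Lambda)):\mathcal H_{\mathrm{vinc}}\to\mathbb Q$ is the linear map with $\langle\mathsf{GPC}((\mathfrak L,\Lambda)),(\mathfrak s,\sigma)\rangle:=\#\{A\subset[N]\mid\mathbf{std}(\mathfrak L(A))\ge\mathfrak s,\ \mathbf{st}(\Lambda|_A)=\sigma\}$; and $\langle f\otimes g,x\otimes y\rangle:=\langle f,x\rangle\langle g,y\rangle$. *)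

(* Defs.v *)
From HB Require Import structures.
From mathcomp Require Import all_boot all_order all_algebra all_fingroup.
From mathcomp Require Import finmap monalg.

Set Implicit Arguments.
Unset Strict Implicit.
Unset Printing Implicit Defensive.

Import GRing.Theory.

Local Open Scope ring_scope.

(* Positions are numbered from 0: the ground set [n] = {1, ..., n} is 'I_n,
   with i : 'I_n standing for i + 1.  A finite subset of the positive integers
   is a set E : {set 'I_N} for any large enough N, and an interval partition
   of E is a set of sets in {set {set 'I_N}} with cover E. *)

Section IntervalPartitions.
Variable N : nat.
Implicit Types (A E c : {set 'I_N}) (I : {set {set 'I_N}}).

Definition is_interval E : bool :=
  [exists a : 'I_N, exists b : 'I_N, E == [set i : 'I_N | (a <= i <= b)%N]].

Definition is_IP A I : bool :=
  partition I A && [forall E in I, is_interval E].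

Definition cliques A : {set {set 'I_N}} :=
  [set c | maxset (fun c => [&& c != set0, is_interval c & c \subset A]) c].

Definition IP_restr I A : {set {set 'I_N}} :=
  [set E :&: c | E in I, c in cliques A] :\ set0.

(* enum_val lists the elements of its set in increasing order, so the preimage
   under it is the image under the order-preserving bijection onto the initial
   segment. *)
Definition IP_std I : {set {set 'I_#|cover I|}} :=
  [set [set k | enum_val k \in E] | E : {set 'I_N} in I].

End IntervalPartitions.

(* The underlying set of integers, independent of the bound N. *)
Definition natset N (E : {set 'I_N}) : {fset nat} :=
  [fset val i | i in E]%fset.

Definition IP_le m n (I : {set {set 'I_m}}) (J : {set {set 'I_n}}) : bool :=
  (natset (cover I) == natset (cover J)) &&
  [forall E in I, exists F in J, (natset E `<=` natset F)%fset].

Definition StIP (n : nat) : Type := {I : {set {set 'I_n}} | is_IP [set: 'I_n] I}.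
HB.instance Definition _ n := SubFinite.on (StIP n).

Section Concatenation.
Variables m n : nat.

Definition IP_cat (s : {set {set 'I_m}}) (t : {set {set 'I_n}}) :
    {set {set 'I_(m + n)}} :=
  [set @lshift m n @: (E : {set 'I_m}) | E in s] :|:
  [set @rshift m n @: (E : {set 'I_n}) | E in t].

Lemma is_interval_lshift (E : {set 'I_m}) :
  is_interval E -> is_interval (@lshift m n @: E).
Proof.
move=> /existsP[a /existsP[b /eqP->]].
apply/existsP; exists (lshift n a); apply/existsP; exists (lshift n b).
apply/eqP/setP => i; rewrite inE; case: (split_ordP i) => j ->.
  by rewrite mem_imset ?inE //; exact: lshift_inj.
rewrite /= (leqNgt (m + j)) (leq_trans (ltn_ord b)) ?leq_addr ?andbF //.
by apply/negbTE/imsetP => -[k _ /eqP]; rewrite eq_rlshift.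
Qed.

Lemma is_interval_rshift (E : {set 'I_n}) :
  is_interval E -> is_interval (@rshift m n @: E).
Proof.
move=> /existsP[a /existsP[b /eqP->]].
apply/existsP; exists (rshift m a); apply/existsP; exists (rshift m b).
apply/eqP/setP => i; rewrite inE; case: (split_ordP i) => j ->.
  rewrite /= (leqNgt (m + a)) (leq_trans (ltn_ord j)) ?leq_addr //=.
  by apply/negbTE/imsetP => -[k _ /eqP]; rewrite eq_lrshift.
rewrite mem_imset ?inE /= ?leq_add2l //; exact: rshift_inj.
Qed.

Lemma IP_cat_subproof (s : StIP m) (t : StIP n) :
  is_IP [set: 'I_(m + n)] (IP_cat (val s) (val t)).
Proof.
case: s t => [s sP] [t tP] /=.
case/andP: sP => /and3P[/eqP cs ts zs] /forall_inP is_.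
case/andP: tP => /and3P[/eqP ct tt zt] /forall_inP it.
apply/andP; split; last first.
  apply/forall_inP => E /setUP[] /imsetP[F Fs ->].
    exact/is_interval_lshift/is_.
  exact/is_interval_rshift/it.
apply/and3P; split.
- apply/eqP/setP => i; rewrite inE; apply/bigcupP.
  case: (split_ordP i) => j ->.
    have: j \in cover s by rewrite cs inE.
    case/bigcupP => E Es jE; exists (@lshift m n @: E); last exact: imset_f.
    by apply/setUP; left; exact: imset_f.
  have: j \in cover t by rewrite ct inE.
  case/bigcupP => E Et jE; exists (@rshift m n @: E); last exact: imset_f.
  by apply/setUP; right; exact: imset_f.
- apply/trivIsetP => A B.
  have lr (E : {set 'I_m}) (F : {set 'I_n}) :
      [disjoint @lshift m n @: E & @rshift m n @: F].
    rewrite disjoint_subset; apply/subsetP => _ /imsetP[i _ ->].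
    by apply/negP => /imsetP[j _ /eqP]; rewrite eq_lrshift.
  move=> /setUP[] /imsetP[E Es ->] /setUP[] /imsetP[F Fs ->] neq.
  + rewrite imset_disjoint; last exact: lshift_inj.
    by apply: (trivIsetP ts) => //; apply: contraNneq neq => ->.
  + exact: lr.
  + by rewrite disjoint_sym; exact: lr.
  + rewrite imset_disjoint; last exact: rshift_inj.
    by apply: (trivIsetP tt) => //; apply: contraNneq neq => ->.
- by apply/negP => /setUP[] /imsetP[E Es] /esym/eqP; rewrite imset_eq0 => /eqP E0;
    move: zs zt; rewrite -E0 Es ?andbF.
Qed.

Definition StIP_cat (s : StIP m) (t : StIP n) : StIP (m + n) :=
  Sub (IP_cat (val s) (val t)) (IP_cat_subproof s t).

Definition perm_sq_fun (sigma : 'S_m) (tau : 'S_n) (i : 'I_(m + n)) :=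
  match split i with
  | inl j => lshift n (sigma j)
  | inr k => rshift m (tau k)
  end.

Lemma perm_sq_subproof sigma tau : injective (perm_sq_fun sigma tau).
Proof.
move=> i j; rewrite /perm_sq_fun.
case: (split_ordP i) => i' ->; case: (split_ordP j) => j' ->;
  rewrite ?lsplitK ?rsplitK => /eqP.
all: rewrite ?(inj_eq (@lshift_inj _ _)) ?(inj_eq (@rshift_inj _ _)) ?eq_lrshift ?eq_rlshift //.
all: by move=> /eqP/perm_inj->.
Qed.

Definition perm_sq (sigma : 'S_m) (tau : 'S_n) : 'S_(m + n) :=
  perm (@perm_sq_subproof sigma tau).

End Concatenation.

Section PermStandardization.
Variables (N : nat) (sigma : 'S_N) (A : {set 'I_N}).

Lemma perm_st_bound (i : 'I_#|A|) :
  (#|[set b in A | (sigma b < sigma (enum_val i))%N]| < #|A|)%N.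
Proof.
apply: proper_card; apply/properP; split.
  by apply/subsetP => b /[!inE] /andP[].
by exists (enum_val i); rewrite ?enum_valP // !inE ltnn andbF.
Qed.

Definition perm_st_fun (i : 'I_#|A|) : 'I_#|A| := Ordinal (perm_st_bound i).

Lemma perm_st_fun_ltn i j :
  (perm_st_fun i < perm_st_fun j)%N = (sigma (enum_val i) < sigma (enum_val j))%N.
Proof.
rewrite /perm_st_fun /=; case: (ltnP (sigma (enum_val i))) => [lt|le].
  apply: proper_card; apply/properP; split.
    by apply/subsetP => b /[!inE] /andP[-> /ltn_trans]; exact.
  by exists (enum_val i); rewrite !inE ?enum_valP // ltnn.
apply/negbTE; rewrite -leqNgt; apply/subset_leq_card/subsetP => b.
by rewrite !inE => /andP[-> /leq_trans]; exact.
Qed.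

Lemma perm_st_subproof : injective perm_st_fun.
Proof.
have le i j : perm_st_fun i = perm_st_fun j ->
    (sigma (enum_val i) <= sigma (enum_val j))%N.
  move=> eq_ij; rewrite leqNgt -(perm_st_fun_ltn j i) eq_ij.
  by rewrite (ltnn (perm_st_fun j)).
move=> i j eq_ij; apply: enum_val_inj; apply: (@perm_inj _ sigma).
apply: val_inj; apply/anti_leq/andP; split; exact: le.
Qed.

Definition perm_st : 'S_#|A| := perm perm_st_subproof.

Lemma perm_st_ltn i j :
  (perm_st i < perm_st j)%N = (sigma (enum_val i) < sigma (enum_val j))%N.
Proof. by rewrite !permE perm_st_fun_ltn. Qed.

End PermStandardization.

Definition permn : Type := {n : nat & 'S_n}.

Definition mkperm n (sigma : 'S_n) : permn := Tagged (fun n => 'S_n) sigma.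

Definition basis : Type := {n : nat & (StIP n * 'S_n)%type}.
HB.instance Definition _ := Choice.on basis.

Definition mkbasis n (s : StIP n) (sigma : 'S_n) : basis :=
  Tagged (fun n => (StIP n * 'S_n)%type) (s, sigma).

Definition bsq (x y : basis) : basis :=
  mkbasis (StIP_cat (tagged x).1 (tagged y).1)
          (perm_sq (tagged x).2 (tagged y).2).

Definition Hvinc := {malg rat[basis]}.

(* The tensor square of a free module is free on the pairs of basis elements. *)
Definition Hvinc2 := {malg rat[(basis * basis)%type]}.

Section Tensor.
Variable K : choiceType.

Definition tens (x y : {malg rat[K]}) : {malg rat[(K * K)%type]} :=
  \sum_(a <- msupp x) \sum_(b <- msupp y) << x@_a * y@_b *g (a, b) >>.

Lemma tensUU (a c : K) : tens << a >> << c >> = << (a, c) >>.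
Proof.
by rewrite /tens !msuppU oner_eq0 !big_seq_fset1 !mcoeffUU mul1r.
Qed.

End Tensor.

Section LinearExtension.
Variables (K : choiceType) (V : lmodType rat) (f : K -> V).

Definition linext (h : {malg rat[K]}) : V := \sum_(k <- msupp h) h@_k *: f k.

Lemma linextEw (d : {fset K}) h :
  (msupp h `<=` d)%fset -> linext h = \sum_(k <- d) h@_k *: f k.
Proof.
move=> le; rewrite /linext (big_fset_incl _ le) // => k _ /mcoeff_outdom->.
by rewrite scale0r.
Qed.

Lemma linext_is_linear : linear linext.
Proof.
move=> c x y; pose d := (msupp (c *: x + y) `|` (msupp x `|` msupp y))%fset.
rewrite (@linextEw d) ?fsubsetUl // (@linextEw d x) ?(@linextEw d y).
- rewrite scaler_sumr -big_split /=; apply: eq_bigr => k _.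
  by rewrite mcoeffD mcoeffZ scalerDl scalerA.
- by rewrite fsubsetU // fsubsetUr orbT.
- by rewrite fsubsetU // fsubsetUl orbT.
Qed.

HB.instance Definition _ :=
  GRing.isLinear.Build rat {malg rat[K]} V *:%R linext linext_is_linear.

Lemma linextU k : linext << k >> = f k.
Proof. by rewrite /linext msuppU oner_eq0 big_seq_fset1 mcoeffUU scale1r. Qed.

End LinearExtension.

Section TensorForm.
Variables (K : choiceType) (f g : {linear {malg rat[K]} -> rat^o}).

Definition tens_form : {linear {malg rat[(K * K)%type]} -> rat^o} :=
  linext (fun p : K * K => f << p.1 >> * g << p.2 >> : rat^o).

Lemma tens_formE x y : tens_form (tens x y) = f x * g y.
Proof.
have UE (J : choiceType) (c : rat) (k : J) : << c *g k >> = c *: << k >>.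
  by apply/malgP => k'; rewrite mcoeffZ !mcoeffU mulrnAr mulr1.
have expand (h : {linear {malg rat[K]} -> rat^o}) z :
    h z = \sum_(a <- msupp z) z@_a * h << a >>.
  rewrite {1}[z]monalgE linear_sum; apply: eq_bigr => a _.
  by rewrite UE linearZ.
rewrite (expand f) (expand g) mulr_suml linear_sum; apply: eq_bigr => a _.
rewrite mulr_sumr linear_sum; apply: eq_bigr => b _.
by rewrite UE linearZ /= linextU mulrACA.
Qed.

End TensorForm.

(* The size of a product is the sum of the sizes, so only factors of size at
   most that of b occur (see coproductE). *)
Definition coproduct_basis (b : basis) : Hvinc2 :=
  \sum_(m < (tag b).+1) \sum_(n < (tag b).+1)
    \sum_(a : StIP m * 'S_m) \sum_(c : StIP n * 'S_n |
        bsq (mkbasis a.1 a.2) (mkbasis c.1 c.2) == b)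
      tens << mkbasis a.1 a.2 >> << mkbasis c.1 c.2 >>.

Definition coproduct : {linear Hvinc -> Hvinc2} := linext coproduct_basis.

Lemma sum_Tagged2 (T : nat -> finType) (F : {n & T n} -> {n & T n} -> rat)
    (N : nat) (x y : {n & T n}) :
  (tag x < N)%N -> (tag y < N)%N ->
  (forall u v, (u == x) && (v == y) = false -> F u v = 0) ->
  \sum_(m < N) \sum_(n < N) \sum_(a : T m) \sum_(c : T n)
    F (Tagged T a) (Tagged T c) = F x y.
Proof.
case: x y => [m a] [n c] /= lt_m lt_n F0.
rewrite (bigD1 (Ordinal lt_m)) //= (bigD1 (Ordinal lt_n)) //= (bigD1 a) //=.
rewrite (bigD1 c) //= !big1 ?addr0 //.
- move=> m' neq; rewrite big1 // => n' _; rewrite big1 // => a' _.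
  rewrite big1 // => c' _; apply: F0; apply/negP => /andP[/eqP eq_m _].
  by case/eqP: neq; apply: val_inj; exact: (congr1 (@tag _ _) eq_m).
- move=> n' neq; rewrite big1 // => a' _; rewrite big1 // => c' _.
  apply: F0; apply/negP => /andP[_ /eqP eq_n].
  by case/eqP: neq; apply: val_inj; exact: (congr1 (@tag _ _) eq_n).
- move=> a' neq; rewrite big1 // => c' _; apply: F0.
  by rewrite eq_Tagged /= (negPf neq).
- by move=> c' neq; apply: F0; rewrite !eq_Tagged /= (negPf neq) andbF.
Qed.

Lemma coproductE (b x y : basis) :
  (coproduct << b >>)@_(x, y) = (bsq x y == b)%:R.
Proof.
pose F (u v : basis) : rat :=
  if bsq u v == b then ((u == x) && (v == y))%:R else 0.
transitivity (F x y); last by rewrite /F !eqxx; case: eqP.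
have F0 u v : (u == x) && (v == y) = false -> F u v = 0.
  by rewrite /F => ->; case: ifP.
transitivity (\sum_(m < (tag b).+1) \sum_(n < (tag b).+1)
    \sum_(a : StIP m * 'S_m) \sum_(c : StIP n * 'S_n)
      F (mkbasis a.1 a.2) (mkbasis c.1 c.2)).
  rewrite /coproduct /= linextU /coproduct_basis raddf_sum /=.
  apply: eq_bigr => m _; rewrite raddf_sum; apply: eq_bigr => n _.
  rewrite raddf_sum; apply: eq_bigr => a _; rewrite raddf_sum big_mkcond.
  by apply: eq_bigr => c _; rewrite tensUU /= mcoeffU xpair_eqE.
have [le_b|] := boolP ((tag x < (tag b).+1)%N && (tag y < (tag b).+1)%N).
  case/andP: le_b => lt_x lt_y; rewrite -(sum_Tagged2 lt_x lt_y F0).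
  apply: eq_bigr => m _; apply: eq_bigr => n _; apply: eq_bigr => -[? ?] _.
  by apply: eq_bigr => -[? ?] _.
have tagD : bsq x y = b -> (tag x < (tag b).+1)%N && (tag y < (tag b).+1)%N.
  by move=> <-; rewrite /= !ltnS leq_addr leq_addl.
move=> gt_b; rewrite {2}/F; case: eqP => [/tagD|_]; first by rewrite (negPf gt_b).
rewrite big1 // => m _; rewrite big1 // => n _; rewrite big1 // => a _.
rewrite big1 // => c _; apply: F0; apply/negP => /andP[/eqP eq_x /eqP eq_y].
by move: gt_b; rewrite -eq_x -eq_y /= !ltn_ord.
Qed.

Definition GPC (x : basis) : {linear Hvinc -> rat^o} :=
  linext (fun y : basis =>
    #|[set A : {set 'I_(tag x)} |
        IP_le (val (tagged y).1) (IP_std (IP_restr (val (tagged x).1) A)) &&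
        (mkperm (perm_st (tagged x).2 A) == mkperm (tagged y).2)]|%:R : rat^o).

(* Main.v *)
(* A subset A of [N1 + N2] is the same as a pair (B, C) of subsets of [N1] and
   [N2].  No block of L . M meets both halves, so the restriction of L . M to A
   is, after standardization, the concatenation of those of L to B and of M to
   C, even if a clique of A straddles the two halves; likewise st(A) is
   st(B) [] st(C).  Hence (s, sigma) occurs at A iff it factors as a product of a
   basis element occurring at B and one occurring at C.  Such a factorization is
   unique, its sizes being #|B| and #|C|, so that for each (B, C) the sum over
   the terms of the coproduct is 0 or 1.  Summing over (B, C) gives the claim. *)

Require Import Defs.
From mathcomp Require Import all_boot all_order all_algebra all_fingroup.
From mathcomp Require Import finmap monalg.

Set Implicit Arguments.
Unset Strict Implicit.

Import GRing.Theory.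

Local Open Scope ring_scope.

(** * Sets of ordinals as sets of natural numbers *)

Section Natset.
Local Open Scope nat_scope.

Lemma natsetP {N} {E : {set 'I_N}} {x : nat} :
  reflect (exists2 i : 'I_N, i \in E & x = i) (x \in natset E).
Proof. by apply: (iffP (imfsetP _ _ _ _)) => -[i iE ->]; exists i. Qed.

Lemma mem_natset {N} (E : {set 'I_N}) (i : 'I_N) :
  (nat_of_ord i \in natset E) = (i \in E).
Proof.
by apply/natsetP/idP => [[j jE /val_inj->] //|iE]; exists i.
Qed.

Lemma mem_natsetT N x : (x \in natset [set: 'I_N]) = (x < N).
Proof.
apply/natsetP/idP => [[i _ ->] //|lt_x]; by exists (Ordinal lt_x); rewrite ?inE.
Qed.

Lemma natset_lshift m n (E : {set 'I_m}) : natset (@lshift m n @: E) = natset E.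
Proof.
apply/fsetP => x; apply/natsetP/natsetP => [[_ /imsetP[i iE ->] ->]|[i iE ->]].
  by exists i.
by exists (lshift n i); rewrite ?imset_f.
Qed.

Lemma natset_rshift m n (E : {set 'I_n}) x :
  (x \in natset (@rshift m n @: E)) = (m <= x) && (x - m \in natset E).
Proof.
apply/natsetP/andP => [[_ /imsetP[i iE ->] ->]|[le_x /natsetP[i iE eq_i]]].
  by rewrite leq_addr addKn mem_natset.
by exists (rshift m i); rewrite ?imset_f //= -eq_i subnKC.
Qed.

Lemma natsetU N (E F : {set 'I_N}) x :
  (x \in natset (E :|: F)) = (x \in natset E) || (x \in natset F).
Proof.
apply/natsetP/orP => [[i /setUP[] iE ->]|[] /natsetP[i iE ->]].
- by left; rewrite mem_natset.
- by right; rewrite mem_natset.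
- by exists i; rewrite ?inE ?iE.
- by exists i; rewrite ?inE ?iE ?orbT.
Qed.

End Natset.

(** * Increasing enumerations and pairs of subsets *)

Section Elements.
Local Open Scope nat_scope.

(** Natural numbers can be compared across ordinal types without casts; this matters because
    [#|setcat B C|] and [#|B| + #|C|] are only propositionally equal. *)
Definition elements N (A : {set 'I_N}) : seq nat := [seq val i | i <- enum A].

Lemma mem_elements N (A : {set 'I_N}) x : (x \in elements A) = (x \in natset A).
Proof.
apply/mapP/natsetP => -[i iA ->]; exists i => //; by rewrite ?mem_enum // in iA *.
Qed.

Lemma size_elements N (A : {set 'I_N}) : size (elements A) = #|A|.
Proof. by rewrite size_map -cardE. Qed.

Lemma sorted_elements N (A : {set 'I_N}) : sorted ltn (elements A).
Proof.
apply: (@subseq_sorted _ _ ltn_trans _ (iota 0 N)); last exact: iota_ltn_sorted.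
rewrite -val_enum_ord; apply: map_subseq.
by rewrite enumT {1}/enum_mem; exact: filter_subseq.
Qed.

Lemma nth_elements N (A : {set 'I_N}) (k : 'I_#|A|) :
  nth 0 (elements A) k = enum_val k.
Proof. by rewrite (nth_map (enum_default k)) -?cardE. Qed.

Definition setcat {m n} (B : {set 'I_m}) (C : {set 'I_n}) : {set 'I_(m + n)} :=
  (@lshift m n @: B) :|: (@rshift m n @: C).

(** Both lists are strictly increasing, the elements of [B] being below [m], and such lists are
    determined by their members. *)
Lemma elements_setcat m n (B : {set 'I_m}) (C : {set 'I_n}) :
  elements (setcat B C) = elements B ++ [seq m + x | x <- elements C].
Proof.
apply: (irr_sorted_eq ltn_trans ltnn); first exact: sorted_elements.
  rewrite (sorted_pairwise ltn_trans) pairwise_cat.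
  rewrite -!(sorted_pairwise ltn_trans) sorted_elements sorted_map.
  rewrite (eq_sorted (e' := ltn)) ?sorted_elements ?andbT; last first.
    by move=> x y /=; rewrite ltn_add2l.
  apply/allrelP => x _ + /mapP[y _ ->]; rewrite mem_elements => /natsetP[i _ ->].
  exact: ltn_addr.
move=> x; rewrite mem_elements natsetU natset_lshift natset_rshift mem_cat.
rewrite mem_elements; congr (_ || _).
apply/andP/mapP => [[le_x xC]|[y yC ->]].
  by exists (x - m); rewrite ?mem_elements ?subnKC.
by rewrite leq_addr addKn -mem_elements.
Qed.

Lemma card_setcat m n (B : {set 'I_m}) (C : {set 'I_n}) :
  #|setcat B C| = #|B| + #|C|.
Proof. by rewrite -!size_elements elements_setcat size_cat size_map. Qed.

Lemma nth_setcat_lshift m n (B : {set 'I_m}) (C : {set 'I_n}) (k : 'I_#|B|) :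
  nth 0 (elements (setcat B C)) (lshift #|C| k) = nth 0 (elements B) k.
Proof. by rewrite elements_setcat nth_cat size_elements /= ltn_ord. Qed.

Lemma nth_setcat_rshift m n (B : {set 'I_m}) (C : {set 'I_n}) (k : 'I_#|C|) :
  nth 0 (elements (setcat B C)) (rshift #|B| k) = m + nth 0 (elements C) k.
Proof.
rewrite elements_setcat nth_cat size_elements /= ltnNge leq_addr /= addKn.
by rewrite (nth_map 0) ?size_elements.
Qed.

Lemma nth_elements_ltn N (A : {set 'I_N}) (k : 'I_#|A|) :
  nth 0 (elements A) k < N.
Proof. by rewrite nth_elements. Qed.

Lemma setcat_bij m n :
  bijective (fun BC : {set 'I_m} * {set 'I_n} => setcat BC.1 BC.2).
Proof.
exists (fun A : {set 'I_(m + n)} => (@lshift m n @^-1: A, @rshift m n @^-1: A)).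
  case=> B C; congr pair; apply/setP => i; rewrite !inE /=.
    rewrite mem_imset; last exact: lshift_inj.
    by case: imsetP => [[j _ /eqP]|]; rewrite ?orbF // eq_lrshift.
  rewrite orbC mem_imset; last exact: rshift_inj.
  by case: imsetP => [[j _ /eqP]|]; rewrite ?orbF // eq_rlshift.
move=> A; apply/setP => i; rewrite !inE /=; case: (split_ordP i) => j ->.
  rewrite mem_imset ?inE; last exact: lshift_inj.
  by case: imsetP => [[k _ /eqP]|]; rewrite ?orbF // eq_lrshift.
rewrite orbC mem_imset ?inE; last exact: rshift_inj.
by case: imsetP => [[k _ /eqP]|]; rewrite ?orbF // eq_rlshift.
Qed.

End Elements.

(** * Standardization of permutations and products *)

Section Permutations.
Local Open Scope nat_scope.

(** A value of a permutation is the number of values below it, so relative order determines the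
    permutation. *)
Lemma perm_ltn_eq n (sigma tau : 'S_n) :
  (forall i j, (sigma i < sigma j) = (tau i < tau j)) -> sigma = tau.
Proof.
have rankE (rho : 'S_n) i : val (rho i) = #|[set j | rho j < rho i]|.
  (* Counting images instead of indices turns the set into the initial segment below [rho i]. *)
  rewrite -(card_imset _ (@perm_inj _ rho)).
  have -> : rho @: [set j | rho j < rho i] = [set k : 'I_n | k < rho i].
    apply/setP => k; rewrite inE -{1}(permKV rho k) mem_imset ?inE ?permKV //.
    exact: perm_inj.
  rewrite -sum1dep_card (big_ord_narrow (ltnW (ltn_ord (rho i)))).
  by rewrite sum1_card card_ord.
move=> eq_lt; apply/permP => i; apply: val_inj; rewrite (rankE sigma) (rankE tau).
by apply: eq_card => j; rewrite !inE eq_lt.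
Qed.

Lemma mkperm_eq m n (sigma : 'S_m) (tau : 'S_n) (eq_mn : m = n) :
    (forall i j, (sigma i < sigma j) =
       (tau (cast_ord eq_mn i) < tau (cast_ord eq_mn j))) ->
  mkperm sigma = mkperm tau.
Proof.
case: n / eq_mn tau => tau eq_lt; congr mkperm; apply: perm_ltn_eq => i j.
by rewrite eq_lt !cast_ord_id.
Qed.

Lemma mkperm_inj n : injective (@mkperm n).
Proof. by move=> s t /eqP; rewrite /mkperm eq_Tagged => /eqP. Qed.

Lemma perm_st_setcat m n (sigma : 'S_m) (tau : 'S_n)
    (B : {set 'I_m}) (C : {set 'I_n}) :
  mkperm (perm_st (perm_sq sigma tau) (setcat B C)) =
  mkperm (perm_sq (perm_st sigma B) (perm_st tau C)).
Proof.
symmetry; apply: (@mkperm_eq _ _ _ _ (esym (card_setcat B C))) => i j.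
have enum_lshift k :
    enum_val (cast_ord (esym (card_setcat B C)) (lshift #|C| k)) =
    lshift n (enum_val k).
  by apply: val_inj; rewrite /= -nth_elements /= nth_setcat_lshift nth_elements.
have enum_rshift k :
    enum_val (cast_ord (esym (card_setcat B C)) (rshift #|B| k)) =
    rshift m (enum_val k).
  by apply: val_inj; rewrite /= -nth_elements nth_setcat_rshift nth_elements.
have sq_l p q (a : 'S_p) (b : 'S_q) k :
    perm_sq a b (lshift q k) = lshift q (a k).
  by rewrite permE /perm_sq_fun (unsplitK (inl _ k)).
have sq_r p q (a : 'S_p) (b : 'S_q) k :
    perm_sq a b (rshift p k) = rshift p (b k).
  by rewrite permE /perm_sq_fun (unsplitK (inr _ k)).
rewrite perm_st_ltn.
case: (split_ordP i) => {}i ->; case: (split_ordP j) => {}j ->;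
  rewrite ?enum_lshift ?enum_rshift ?sq_l ?sq_r /= ?ltn_add2l ?perm_st_ltn //.
  (* Positions in different halves: left values lie below all right values in both permutations, so
     both comparisons are true here and both are false in the next case. *)
  by rewrite !ltn_addr.
by transitivity false; [|symmetry]; apply/negbTE; rewrite -leqNgt ltnW ?ltn_addr.
Qed.

End Permutations.

(** * The order on interval partitions without cliques *)

Section Order.
Local Open Scope nat_scope.

Lemma is_intervalP {N} {E : {set 'I_N}} :
  reflect (exists a b : 'I_N, E = [set i : 'I_N | a <= i <= b]) (is_interval E).
Proof.
apply: (iffP existsP) => [[a /existsP[b /eqP eqE]]|[a [b ->]]].
  by exists a, b.
by exists a; apply/existsP; exists b.
Qed.

Lemma StIP_neq0 n (s : StIP n) E : E \in val s -> E != set0.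
Proof.
by case: s => s /= /andP[/and3P[_ _ s0] _]; apply: contraTneq => ->.
Qed.

Lemma StIP_interval n (s : StIP n) E : E \in val s -> is_interval E.
Proof. by case: s => s /= /andP[_ /forall_inP]; apply. Qed.

Lemma StIP_cover n (s : StIP n) i : exists2 E, E \in val s & i \in E.
Proof.
have: i \in cover (val s).
  by case: s => s /= /andP[/and3P[/eqP-> _ _] _]; rewrite inE.
by case/bigcupP => E; exists E.
Qed.

Lemma StIP_cover_eq n (s : StIP n) : cover (val s) = [set: 'I_n].
Proof. by case: s => s /= /andP[/and3P[/eqP]]. Qed.

Lemma sub_clique N (A c : {set 'I_N}) :
    is_interval c -> c != set0 -> c \subset A ->
  exists2 d, d \in cliques A & c \subset d.
Proof.
move=> c_int c0 cA.
pose P := fun c : {set 'I_N} => [&& c != set0, is_interval c & c \subset A].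
have Pc : P c by rewrite /P c0 c_int.
by have [d maxd cd] := maxset_exists Pc; exists d; rewrite ?inE.
Qed.

Lemma cliques_sub N (A c : {set 'I_N}) :
  c \in cliques A -> is_interval c && (c \subset A).
Proof. by rewrite inE => /maxsetp /and3P[_ -> ->]. Qed.

Lemma IP_restrP N (I : {set {set 'I_N}}) (A G : {set 'I_N}) :
  reflect (G != set0 /\
           exists E c, [/\ E \in I, c \in cliques A & G = E :&: c])
    (G \in IP_restr I A).
Proof.
apply: (iffP setD1P) => -[G0].
  by case/imset2P => E c EI cA eqG; split=> //; exists E, c.
case=> E [c [EI cA eqG]]; split=> //; rewrite eqG.
by apply/imset2P; exists E c.
Qed.

Lemma cover_IP_restr N (L : StIP N) (A : {set 'I_N}) :
  cover (IP_restr (val L) A) = A.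
Proof.
apply/setP => i; apply/bigcupP/idP => [[G /IP_restrP[_ [E [c [_ cA ->]]]]]|iA].
  by case/cliques_sub/andP: cA => _ /subsetP cA /setIP[_ /cA].
(* A single point of [A] is an interval in [A], hence lies in some clique. *)
have [||| c cA ic] := @sub_clique N A [set i].
- apply/is_intervalP; exists i, i; apply/setP => j.
  by rewrite !inE -eqn_leq eq_sym.
- by apply/set0Pn; exists i; rewrite inE.
- by rewrite sub1set.
rewrite sub1set in ic; have [E EL iE] := StIP_cover L i.
exists (E :&: c); last by rewrite inE iE.
by apply/IP_restrP; split; [apply/set0Pn; exists i; rewrite inE iE | exists E, c].
Qed.

Lemma cover_IP_std N (I : {set {set 'I_N}}) : cover (IP_std I) = setT.
Proof.
apply/setP => k; rewrite inE; have /bigcupP[E EI kE] := enum_valP k.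
by apply/bigcupP; exists [set k | enum_val k \in E]; rewrite ?inE ?imset_f.
Qed.

(* The condition on E for being contained in a block of std(L(A)), without
   reference to cliques: its image in A lies in a block of L and the convex
   hull of this image lies in A. *)
Definition IP_fits N n (L : {set {set 'I_N}}) (A : {set 'I_N}) (E : {set 'I_n}) :=
  let a k := nth 0 (elements A) k in
  (exists2 F, F \in L & forall k : 'I_n, k \in E -> a k \in natset F) /\
  (forall (i j : 'I_n) x, i \in E -> j \in E -> a i <= x <= a j ->
     x \in natset A).

(** The bound [x < #|A|] excludes the indices at which [nth] returns its default value 0. *)
Lemma mem_natset_std N (I : {set {set 'I_N}}) (A G : {set 'I_N}) x :
    cover I = A ->
  (x \in natset [set k : 'I_#|cover I| | enum_val k \in G]) =
  (x < #|A|) && (nth 0 (elements A) x \in natset G).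
Proof.
move=> <-; apply/natsetP/andP => [[k /[!inE] kG ->]|[lt_x xG]].
  by rewrite ltn_ord nth_elements mem_natset.
exists (Ordinal lt_x) => //.
by rewrite inE -mem_natset -(nth_elements (Ordinal lt_x)).
Qed.

Lemma natsetT_inj m n :
  natset [set: 'I_m] = natset [set: 'I_n] -> m = n.
Proof.
move=> eqT; apply/eqP; rewrite eqn_leq [m <= n]leqNgt [n <= m]leqNgt -!mem_natsetT.
by apply/andP; split; [rewrite eqT | rewrite -eqT]; rewrite mem_natsetT ltnn.
Qed.

(** A block of the restriction is some [F :&: c] with [c] a clique. As [c] is an interval inside
    [A], it contains the hull of any of its subsets; conversely, a hull inside [A] is an interval
    and extends to a clique. *)
Lemma IP_leP n N (s : StIP n) (L : StIP N) (A : {set 'I_N}) :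
  reflect (n = #|A| /\ forall E, E \in val s -> IP_fits (val L) A E)
    (IP_le (val s) (IP_std (IP_restr (val L) A))).
Proof.
have covA := cover_IP_restr L A.
rewrite /IP_le StIP_cover_eq cover_IP_std.
have -> : (natset [set: 'I_n] ==
    natset [set: 'I_#|cover (IP_restr (val L) A)|]) = (n == #|A|).
  by rewrite covA; apply/eqP/eqP => [/natsetT_inj|->].
apply: (iffP andP) => [[/eqP eq_n /forall_inP le]|[eq_n le]]; split=> //.
- move=> E /le /exists_inP[_ /imsetP[G GL ->] /fsubsetP sub].
  have {}sub (k : 'I_n) : k \in E -> nth 0 (elements A) k \in natset G.
    move=> kE; have := sub k; rewrite (mem_natset_std _ _ covA) mem_natset.
    by case/(_ kE)/andP.
  case/IP_restrP: GL sub => _ [F [c [FL cA ->]]] sub; split.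
    exists F => // k /sub/natsetP[i /setIP[iF _] ->]; by rewrite mem_natset.
  move=> i j x iE jE /andP[le_ix le_xj].
  (* The clique runs from [a] to [b], and [x] lies between two of its elements. *)
  case/cliques_sub/andP: cA sub => /is_intervalP[a [b ->]] /subsetP cA sub.
  have /natsetP[i' /setIP[_ /[!inE] /andP[le_a _]] eq_i] := sub _ iE.
  have /natsetP[j' /setIP[_ /[!inE] /andP[_ le_b]] eq_j] := sub _ jE.
  have lt_x : x < N by rewrite (leq_ltn_trans le_xj) // eq_j.
  have <- : nat_of_ord (Ordinal lt_x) = x by [].
  rewrite mem_natset; apply: cA; rewrite inE /=.
  by rewrite (leq_trans le_a) -?eq_i // (leq_trans le_xj) ?eq_j.
- by apply/eqP.
apply/forall_inP => E Es; have [[F FL sub] conv] := le E Es.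
subst n; have [k0 k0E] := set0Pn _ (StIP_neq0 Es).
(* The extreme positions of [E] bound its hull [c0], from which the clique is obtained. *)
case: (arg_minnP (fun k : 'I_#|A| => nth 0 (elements A) k) k0E) => kmin minE le_min.
case: (arg_maxnP (fun k : 'I_#|A| => nth 0 (elements A) k) k0E) => kmax maxE ge_max.
pose c0 := [set i : 'I_N | enum_val kmin <= i <= enum_val kmax].
have in_c0 k : k \in E -> enum_val k \in c0.
  move=> kE; rewrite inE -!nth_elements; apply/andP.
  by split; [exact: le_min | exact: ge_max].
have [||| c cA /subsetP c0c] := @sub_clique N A c0.
- by apply/is_intervalP; exists (enum_val kmin), (enum_val kmax).
- by apply/set0Pn; exists (enum_val k0); exact: in_c0.
- apply/subsetP => i; rewrite inE -!nth_elements => le_i.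
  by rewrite -mem_natset; exact: conv le_i.
have in_F k : k \in E -> enum_val k \in F :&: c.
  by move=> kE; rewrite inE c0c ?in_c0 // andbT -mem_natset -nth_elements sub.
apply/exists_inP.
exists [set k : 'I_#|cover (IP_restr (val L) A)| | enum_val k \in F :&: c].
  apply: imset_f; apply/IP_restrP; split; last by exists F, c.
  by apply/set0Pn; exists (enum_val k0); exact: in_F.
apply/fsubsetP => _ /natsetP[k kE ->].
by rewrite (mem_natset_std _ _ covA) ltn_ord nth_elements mem_natset in_F.
Qed.

End Order.

(** * Blocks fitting into a concatenation *)

Section Splitting.
Local Open Scope nat_scope.
Variables N1 N2 : nat.
Implicit Types (B : {set 'I_N1}) (C : {set 'I_N2}).

Lemma mem_natset_setcat B C x :
  (x \in natset (setcat B C)) =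
  (x \in natset B) || (N1 <= x) && (x - N1 \in natset C).
Proof. by rewrite natsetU natset_lshift natset_rshift. Qed.

Lemma natset_ltn N (E : {set 'I_N}) x : x \in natset E -> x < N.
Proof. by case/natsetP => i _ ->. Qed.

(** The hull of positions in [B] stays below [N1], so elements coming from [C] do not affect the
    convexity condition, even if a clique continues past [N1]. *)
Lemma IP_fits_lshift (I : {set {set 'I_N1}}) (J : {set {set 'I_N2}}) B C
    (E : {set 'I_#|B|}) :
    E != set0 ->
  IP_fits (IP_cat I J) (setcat B C) (@lshift #|B| #|C| @: E) <-> IP_fits I B E.
Proof.
case/set0Pn => k0 k0E; split=> -[[F FI sub] conv].
  have {}sub k : k \in E -> nth 0 (elements B) k \in natset F.
    by move=> kE; rewrite -(nth_setcat_lshift C); apply: sub; exact: imset_f.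
  split; last first.
    move=> i j x iE jE le_x.
    have: x \in natset (setcat B C).
      by apply: (conv (lshift _ i) (lshift _ j)); rewrite ?imset_f ?nth_setcat_lshift.
    rewrite mem_natset_setcat leqNgt; case/andP: le_x => _ /leq_ltn_trans->.
      by rewrite orbF.
    exact: nth_elements_ltn.
  case/setUP: FI sub => /imsetP[G GI ->] sub.
    by exists G => // k /sub; rewrite natset_lshift.
  (* A block coming from [J] has no element below [N1], but the image of [k0] is below [N1]. *)
  by have := sub _ k0E; rewrite natset_rshift leqNgt nth_elements_ltn.
split.
  exists (@lshift N1 N2 @: F); first by rewrite inE imset_f.
  by move=> _ /imsetP[k kE ->]; rewrite nth_setcat_lshift natset_lshift sub.
move=> _ _ x /imsetP[i iE ->] /imsetP[j jE ->].
by rewrite !nth_setcat_lshift mem_natset_setcat => /(conv _ _ _ iE jE)->.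
Qed.

Lemma IP_fits_rshift (I : {set {set 'I_N1}}) (J : {set {set 'I_N2}}) B C
    (E : {set 'I_#|C|}) :
    E != set0 ->
  IP_fits (IP_cat I J) (setcat B C) (@rshift #|B| #|C| @: E) <-> IP_fits J C E.
Proof.
case/set0Pn => k0 k0E; split=> -[[F FI sub] conv].
  have {}sub k : k \in E -> N1 + nth 0 (elements C) k \in natset F.
    by move=> kE; rewrite -(nth_setcat_rshift B); apply: sub; exact: imset_f.
  split; last first.
    move=> i j x iE jE le_x.
    (* Convexity in the concatenation is applied to the translate of [x], which is too large to come
       from [B]. *)
    have: N1 + x \in natset (setcat B C).
      apply: (conv (rshift _ i) (rshift _ j)); rewrite ?imset_f //.
      by rewrite !nth_setcat_rshift !leq_add2l.
    rewrite mem_natset_setcat leq_addr addKn; case/orP => // /natset_ltn.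
    by rewrite ltnNge leq_addr.
  case/setUP: FI sub => /imsetP[G GI ->] sub.
    have := sub _ k0E; rewrite natset_lshift => /natset_ltn.
    by rewrite ltnNge leq_addr.
  by exists G => // k /sub; rewrite natset_rshift leq_addr addKn.
split.
  exists (@rshift N1 N2 @: F); first by rewrite inE imset_f ?orbT.
  move=> _ /imsetP[k kE ->].
  by rewrite nth_setcat_rshift natset_rshift leq_addr addKn sub.
move=> _ _ x /imsetP[i iE ->] /imsetP[j jE ->].
rewrite !nth_setcat_rshift mem_natset_setcat => /andP[le_ix le_xj].
(* The lower end of the hull is at least [N1], so subtracting [N1] from [x] loses nothing. *)
have le_x : N1 <= x := leq_trans (leq_addr _ _) le_ix.
rewrite le_x (conv i j) ?orbT // -(leq_add2l N1 _ (x - N1)).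
by rewrite -(leq_add2l N1 (x - N1)) subnKC // le_ix.
Qed.

(** The image of [E] lies in one block of the concatenation, and that block lies in one half. *)
Lemma IP_fits_split (I : {set {set 'I_N1}}) (J : {set {set 'I_N2}}) B C
    (E : {set 'I_(#|B| + #|C|)}) :
    IP_fits (IP_cat I J) (setcat B C) E ->
  E = @lshift _ _ @: (@lshift _ _ @^-1: E) \/
  E = @rshift _ _ @: (@rshift _ _ @^-1: E).
Proof.
case=> -[F + sub] _ => /setUP[] /imsetP[G GI eqF]; [left|right];
  apply/eqP; rewrite eqEsubset; apply/andP; split; apply/subsetP => k;
  (* The image of the preimage always lies in [E]; what remains is that each [k] of [E] falls in the
     half of the block [F]. *)
  do ?[by case/imsetP => i /[!inE] iE ->]; move=> kE; have := sub k kE;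
  rewrite eqF; case: (split_ordP k) kE => i -> iE.
- by rewrite imset_f ?inE.
- by rewrite nth_setcat_rshift => /natsetP[_ /imsetP[j _ ->]] /= eq_j;
    have := ltn_ord j; rewrite -eq_j ltnNge leq_addr.
- by rewrite nth_setcat_lshift natset_rshift leqNgt nth_elements_ltn.
- by rewrite imset_f ?inE.
Qed.

End Splitting.

(** * Factoring a partition as a concatenation, and uniqueness *)

Section SplitStIP.
Local Open Scope nat_scope.

(** This extracts one factor when [f] is one of the two shifts. Blocks meeting the range of [f] lie
    inside it, so their preimages cover everything. *)
Lemma StIP_preim k n (s : StIP n) (f : 'I_k -> 'I_n) :
    {mono f : i j / i <= j} ->
    (forall E i, E \in val s -> f i \in E -> E = f @: (f @^-1: E)) ->
  is_IP [set: 'I_k] [set E : {set 'I_k} | f @: E \in val s].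
Proof.
move=> f_mono f_img.
have f_inj : injective f.
  by move=> i j eq_f; apply/val_inj/anti_leq; rewrite -!f_mono eq_f !leqnn.
have E0 (E : {set 'I_k}) : f @: E \in val s -> E != set0.
  by move=> /StIP_neq0; apply: contraNneq => ->; rewrite imset0.
apply/andP; split; last first.
  apply/forall_inP => E; rewrite inE => fE.
  have /is_intervalP[a [b eqE]] := StIP_interval fE.
  (* A point of [E] yields [a <= b], so both endpoints belong to [f @: E] and have preimages, the
     endpoints of [E]. *)
  have [i iE] := set0Pn _ (E0 _ fE).
  have : f i \in f @: E by exact: imset_f.
  rewrite eqE inE => /andP[le_ai le_ib].
  have /imsetP[a' _ eq_a] : a \in f @: E.
    by rewrite eqE inE leqnn (leq_trans le_ai).
  have /imsetP[b' _ eq_b] : b \in f @: E.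
    by rewrite eqE inE leqnn (leq_trans le_ai).
  apply/is_intervalP; exists a', b'; apply/setP => j.
  by rewrite -(mem_imset _ _ f_inj) eqE !inE eq_a eq_b !f_mono.
apply/and3P; split.
- apply/eqP/setP => i; rewrite inE; have [E Es iE] := StIP_cover s (f i).
  apply/bigcupP; exists (f @^-1: E); last by rewrite inE.
  by rewrite inE -(f_img E i).
- apply/trivIsetP => E F; rewrite !inE => Es Fs neq.
  rewrite -(imset_disjoint f_inj).
  case: s {f_img E0} Es Fs => s /= /andP[/and3P[_ /trivIsetP ts _] _] Es Fs.
  by apply: ts => //; apply: contraNneq neq => /(imset_inj f_inj)->.
- by rewrite inE; apply/negP => /E0; rewrite eqxx.
Qed.

(** The two factors collect the blocks lying in the left and in the right half. *)
Lemma StIP_split k l (s : StIP (k + l)) :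
    (forall E, E \in val s -> E = @lshift k l @: (@lshift k l @^-1: E) \/
                              E = @rshift k l @: (@rshift k l @^-1: E)) ->
  exists a b, StIP_cat a b = s.
Proof.
move=> s_split.
have aP : is_IP [set: 'I_k] [set E : {set 'I_k} | @lshift k l @: E \in val s].
  apply: StIP_preim => [i j //|E i /s_split[] // -> /imsetP[j _ /eqP]].
  by rewrite eq_lrshift.
have bP : is_IP [set: 'I_l] [set E : {set 'I_l} | @rshift k l @: E \in val s].
  apply: StIP_preim => [i j|E i /s_split[] // -> /imsetP[j _ /eqP]].
    exact: leq_add2l.
  by rewrite eq_rlshift.
exists (Sub _ aP), (Sub _ bP); apply: val_inj; apply/setP => E /=.
apply/setUP/idP => [[] /imsetP[F /[!inE] Fs ->] //|Es].
by have [eqE|eqE] := s_split E Es; [left|right];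
  rewrite eqE imset_f // inE -eqE.
Qed.

Lemma StIP_cat_inj k l (a a' : StIP k) (b b' : StIP l) :
  StIP_cat a b = StIP_cat a' b' -> a = a' /\ b = b'.
Proof.
(* A non-empty shifted set reveals its half, so the blocks of each factor can be read off. The empty
   set has the same image under both shifts and is treated apart. *)
have memL (c : StIP k) (d : StIP l) E : E != set0 ->
    (@lshift k l @: E \in val (StIP_cat c d)) = (E \in val c).
  case/set0Pn => i iE.
  apply/setUP/idP => [[] /imsetP[F Fs eqF]|Es]; last by left; exact: imset_f.
    by rewrite (imset_inj (@lshift_inj _ _) eqF).
  have : lshift l i \in @lshift k l @: E by exact: imset_f.
  by rewrite eqF => /imsetP[j _ /eqP]; rewrite eq_lrshift.
have memR (c : StIP k) (d : StIP l) E : E != set0 ->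
    (@rshift k l @: E \in val (StIP_cat c d)) = (E \in val d).
  case/set0Pn => i iE.
  apply/setUP/idP => [[] /imsetP[F Fs eqF]|Es]; last by right; exact: imset_f.
    have : rshift k i \in @rshift k l @: E by exact: imset_f.
    by rewrite eqF => /imsetP[j _ /eqP]; rewrite eq_rlshift.
  by rewrite (imset_inj (@rshift_inj _ _) eqF).
have not0 m (c : StIP m) : (set0 \in val c) = false.
  by apply/negP => /StIP_neq0; rewrite eqxx.
move=> eq_cat; split; apply/val_inj/setP => E.
  have [->|E0] := eqVneq E set0; first by rewrite !not0.
  by rewrite -(memL a b) // eq_cat memL.
have [->|E0] := eqVneq E set0; first by rewrite !not0.
by rewrite -(memR a b) // eq_cat memR.
Qed.

End SplitStIP.

(** * Occurrences at a fixed subset *)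

Definition occurs (x : basis) (A : {set 'I_(tag x)}) (y : basis) : bool :=
  IP_le (val (tagged y).1) (IP_std (IP_restr (val (tagged x).1) A)) &&
  (mkperm (perm_st (tagged x).2 A) == mkperm (tagged y).2).

Lemma GPCE (x y : basis) :
  GPC x << y >> = \sum_(A : {set 'I_(tag x)}) (occurs A y)%:R :> rat.
Proof.
rewrite /GPC /= linextU -sum1dep_card natr_sum big_mkcond /=.
by apply: eq_bigr => A _; rewrite /occurs; case: ifP.
Qed.

(** The subset fixes the size and the permutation of whatever occurs at it; only the partition can
    vary. *)
Lemma occurs_perm_st N (L : StIP N) (Lambda : 'S_N) (A : {set 'I_N}) (y : basis) :
  @occurs (mkbasis L Lambda) A y -> exists s, y = mkbasis s (perm_st Lambda A).
Proof.
case: y => m [a alpha] /andP[/IP_leP[/= eq_m _] /eqP /= eq_p].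
by subst m; exists a; rewrite (mkperm_inj eq_p).
Qed.

Section Occurrences.
Variables (N1 N2 : nat) (L : StIP N1) (Lambda : 'S_N1) (M : StIP N2) (Mu : 'S_N2).
Variables (B : {set 'I_N1}) (C : {set 'I_N2}).

Let x1 := mkbasis L Lambda.
Let x2 := mkbasis M Mu.

Lemma occurs_bsq (y1 y2 : basis) :
  @occurs x1 B y1 -> @occurs x2 C y2 ->
  @occurs (bsq x1 x2) (setcat B C) (bsq y1 y2).
Proof.
move=> occ1 occ2.
have [a eq1] := occurs_perm_st occ1; have [b eq2] := occurs_perm_st occ2.
subst y1 y2; case/andP: occ1 => /IP_leP[_ fits1] _.
case/andP: occ2 => /IP_leP[_ fits2] _.
apply/andP; split; last by apply/eqP/perm_st_setcat.
apply/IP_leP; split; first by rewrite card_setcat.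
move=> _ /setUP[] /imsetP[E Es ->].
  by apply/IP_fits_lshift; [exact: StIP_neq0 Es | exact: fits1].
by apply/IP_fits_rshift; [exact: StIP_neq0 Es | exact: fits2].
Qed.

Lemma occurs_bsq_split (y : basis) :
    @occurs (bsq x1 x2) (setcat B C) y ->
  exists y1 y2, [/\ bsq y1 y2 = y, @occurs x1 B y1 & @occurs x2 C y2].
Proof.
case: y => n [s sigma] /andP[/IP_leP[/= eq_n fits] /eqP /= eq_p].
rewrite card_setcat in eq_n; subst n; rewrite perm_st_setcat in eq_p.
have {sigma eq_p} <- := mkperm_inj eq_p.
(* Every block of [s] fits, hence stays in one half, so [s] factors at [#|B|]. *)
have [E /fits|a [b eq_s]] := @StIP_split _ _ s; first exact: IP_fits_split.
subst s; exists (mkbasis a (perm_st Lambda B)), (mkbasis b (perm_st Mu C)).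
split=> //; apply/andP; split=> //; apply/IP_leP; split=> // E Es.
  apply/(IP_fits_lshift _ (val M) C); first exact: StIP_neq0 Es.
  by apply: fits; rewrite inE imset_f.
apply/(IP_fits_rshift (val L) _ B); first exact: StIP_neq0 Es.
by apply: fits; rewrite inE imset_f ?orbT.
Qed.

(** The product alone is not injective, since the empty basis element is a unit on both sides.
    Occurring at [B] and [C] fixes the sizes of the factors, and then concatenation is injective. *)
Lemma occurs_bsq_inj (y1 y2 z1 z2 : basis) :
    @occurs x1 B y1 -> @occurs x2 C y2 -> @occurs x1 B z1 -> @occurs x2 C z2 ->
  bsq y1 y2 = bsq z1 z2 -> y1 = z1 /\ y2 = z2.
Proof.
move=> /occurs_perm_st[a ->] /occurs_perm_st[b ->].
move=> /occurs_perm_st[a' ->] /occurs_perm_st[b' ->] /eqP.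
by rewrite /bsq eq_Tagged => /eqP/(congr1 fst)/StIP_cat_inj[/= -> ->].
Qed.

Lemma sum_occurs (y : basis) :
  \sum_(m < (tag y).+1) \sum_(n < (tag y).+1)
    \sum_(a : StIP m * 'S_m) \sum_(c : StIP n * 'S_n |
        bsq (mkbasis a.1 a.2) (mkbasis c.1 c.2) == y)
      (@occurs x1 B (mkbasis a.1 a.2))%:R * (@occurs x2 C (mkbasis c.1 c.2))%:R
  = (@occurs (bsq x1 x2) (setcat B C) y)%:R :> rat.
Proof.
(* The constraint from the coproduct is absorbed into the summand, making the index ranges
   independent as in [sum_Tagged2]. *)
pose F (u v : basis) : rat :=
  [&& bsq u v == y, @occurs x1 B u & @occurs x2 C v]%:R.
transitivity (\sum_(m < (tag y).+1) \sum_(n < (tag y).+1)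
    \sum_(a : StIP m * 'S_m) \sum_(c : StIP n * 'S_n)
      F (mkbasis a.1 a.2) (mkbasis c.1 c.2)).
  apply: eq_bigr => m _; apply: eq_bigr => n _; apply: eq_bigr => a _.
  rewrite big_mkcond; apply: eq_bigr => c _; rewrite /F -natrM mulnb.
  by case: eqP.
have [/occurs_bsq_split[y1 [y2 [eq_y occ1 occ2]]]|nocc] := boolP (occurs _ _).
  transitivity (F y1 y2); last by rewrite /F eq_y eqxx occ1 occ2.
  (* Only the term at [(y1, y2)] survives: both sizes are within the range of summation, and any
     other nonzero term would be a second factorization. *)
  rewrite -(@sum_Tagged2 (fun n => (StIP n * 'S_n)%type) F (tag y).+1).
  - apply: eq_bigr => m _; apply: eq_bigr => n _; apply: eq_bigr => -[? ?] _.
    by apply: eq_bigr => -[? ?] _.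
  - by rewrite -eq_y /= ltnS leq_addr.
  - by rewrite -eq_y /= ltnS leq_addl.
  move=> u v; rewrite /F; case: and3P => // -[/eqP eq_uv occu occv].
  have [-> ->] := occurs_bsq_inj occu occv occ1 occ2 (etrans eq_uv (esym eq_y)).
  by rewrite !eqxx.
rewrite big1 // => m _; rewrite big1 // => n _; rewrite big1 // => a _.
rewrite big1 // => c _; rewrite /F; case: and3P => // -[/eqP eq_y occ1 occ2].
by case/negP: nocc; rewrite -eq_y occurs_bsq.
Qed.

End Occurrences.

(** * Summation over all pairs of subsets *)

Theorem theorem4p20 (N1 N2 : nat)
    (L : StIP N1) (Lambda : 'S_N1) (M : StIP N2) (Mu : 'S_N2)
    (n : nat) (s : StIP n) (sigma : 'S_n) :
  GPC (bsq (mkbasis L Lambda) (mkbasis M Mu)) << mkbasis s sigma >> =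
  tens_form (GPC (mkbasis L Lambda)) (GPC (mkbasis M Mu))
    (coproduct << mkbasis s sigma >>).
Proof.
set y := mkbasis s sigma; rewrite GPCE.
have [g gK Kg] := setcat_bij N1 N2.
rewrite (reindex (fun BC : {set 'I_N1} * {set 'I_N2} => setcat BC.1 BC.2));
  last by exists g => ? _.
under eq_bigr => BC _ do rewrite -sum_occurs.
have -> : coproduct << y >> = coproduct_basis y by exact: linextU.
(* The sum over pairs moves inward past the four sums of the coproduct, one at a time, while
   linearity moves the form past the same sums. *)
rewrite exchange_big linear_sum; apply: eq_bigr => m _.
rewrite exchange_big linear_sum; apply: eq_bigr => k _.
rewrite exchange_big linear_sum; apply: eq_bigr => a _.
rewrite exchange_big linear_sum; apply: eq_bigr => c _.
(* For fixed factors, the sum over pairs of subsets is the product of the two counts. *)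
by rewrite tens_formE !GPCE big_distrlr pair_bigA.
Qed.
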